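(* Let $k\geq 0$ be an integer and let $\ell$ be a prime with $\ell\equiv 3 \pmod{5}$. Then for every nonnegative integer $n$ with $\left(\frac{-n}{\ell}\right)=-1$, \[ \overline{p}(4^k\cdot 5\ell^2 n)\equiv 0 \pmod{5}. \]
   Context: An overpartition of a nonnegative integer $n$ is a partition of $n$ in which the first occurrence of each distinct part may be overlined. $\overline{p}(n)$ denotes the number of overpartitions of $n$, with $\overline{p}(0)=1$; equivalently $\sum_{n\ge0}\overline{p}(n)q^n=\prod_{k\ge1}\frac{1+q^k}{1-q^k}$. $\left(\frac{\cdot}{\ell}\right)$ is the Legendre symbol. *)

(* Defs.v *)
From mathcomp Require Import all_boot all_order all_algebra.
Set Implicit Arguments. Unset Strict Implicit. Unset Printing Implicit Defensive.

Fixpoint parts_le (fuel m n : nat) : seq (seq nat) :=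
  match fuel with
  | 0 => if n == 0 then [:: [::]] else [::]
  | fuel'.+1 =>
      if n == 0 then [:: [::]] else
      flatten [seq [seq (j.+1) :: s | s <- parts_le fuel' (j.+1) (n - j.+1)]
              | j <- iota 0 (minn m n)]
  end.

Definition partitions (n : nat) : seq (seq nat) := parts_le n n n.

(* Overpartitions: the first occurrence of each distinct part may be overlined,
   so a partition with d distinct parts gives 2^d overpartitions. *)
Definition overpartition_count (n : nat) : nat :=
  \sum_(s <- partitions n) 2 ^ size (undup s).

Definition legendre (a : int) (p : nat) : int :=
  if (p%:Z %| a)%Z then 0%R
  else if [exists x : 'I_p, (((x%:Z ^+ 2 - a)%R) %% p%:Z)%Z == 0%R] then 1%R else (-1)%R.

(* Main.v *)
Require Import Defs.
From mathcomp Require Import all_boot all_order all_algebra.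
From mathcomp Require Import ring zify.
Set Implicit Arguments. Unset Strict Implicit. Unset Printing Implicit Defensive.
Import Order.TTheory GRing.Theory Num.Theory.
Local Open Scope ring_scope.

(** Let theta = sum_j (-1)^j q^(j^2).  Gauss' identity says that the generating function of
    overpartitions is 1 / theta, and theta^5 = theta(q^5) mod 5, so sum pbar(n) q^n = theta^4 /
    theta(q^5) mod 5.  The coefficient of q^n in theta^k is (-1)^n r_k(n), where r_k counts
    representations by k squares.  Extracting the exponents divisible by 5 and using
    r_4(5n) = r_4(n) mod 5 leaves theta^3, i.e. pbar(5n) = (-1)^n r_3(n) mod 5.  Finally
    r_3(4n) = r_3(n), and r_3(l^2 n) = (l + 2) r_3(n) when -n is a nonresidue mod l; here 5 | l + 2.

    The relations for r_3 and r_4 come from double counting with the 8(l + 1) integral (Lipschitz)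
    quaternions a of norm l.  If l divides N(x) but not x, exactly 8 of them divide x on the left:
    existence is Lagrange's descent, and two of them differ by a right unit.  For r_4 one counts
    the factorizations x = a y, for r_3 the rotations w = a v conj(a) of pure quaternions. *)

(** * Quaternions over a commutative ring *)

Notation quat R := (R * R * R * R)%type.

Section QuaternionAlgebra.
Variable R : comNzRingType.
Implicit Types (x y z a b c d s : quat R) (r : R).

Definition qre x : R := x.1.1.1.

Definition qmul x y : quat R :=
  let: (x0, x1, x2, x3) := x in let: (y0, y1, y2, y3) := y in
  (x0 * y0 - x1 * y1 - x2 * y2 - x3 * y3,
   x0 * y1 + x1 * y0 + x2 * y3 - x3 * y2,
   x0 * y2 - x1 * y3 + x2 * y0 + x3 * y1,
   x0 * y3 + x1 * y2 - x2 * y1 + x3 * y0).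

Definition qconj x : quat R := let: (x0, x1, x2, x3) := x in (x0, - x1, - x2, - x3).

Definition qscale r x : quat R := let: (x0, x1, x2, x3) := x in (r * x0, r * x1, r * x2, r * x3).

Definition qnorm x : R :=
  let: (x0, x1, x2, x3) := x in x0 ^+ 2 + x1 ^+ 2 + x2 ^+ 2 + x3 ^+ 2.

Definition qtr x : R := qre x *+ 2.

Lemma qmulA x y z : qmul x (qmul y z) = qmul (qmul x y) z.
Proof.
by case: x y z => [[[? ?] ?] ?] [[[? ?] ?] ?] [[[? ?] ?] ?]; congr (_, _, _, _) => /=; ring.
Qed.

Lemma qmul0q x : qmul 0 x = 0.
Proof. by case: x => [[[? ?] ?] ?]; congr (_, _, _, _) => /=; ring. Qed.

Lemma qmulq0 x : qmul x 0 = 0.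
Proof. by case: x => [[[? ?] ?] ?]; congr (_, _, _, _) => /=; ring. Qed.

Lemma qmulBr x y z : qmul x (y - z) = qmul x y - qmul x z.
Proof.
by case: x y z => [[[? ?] ?] ?] [[[? ?] ?] ?] [[[? ?] ?] ?]; congr (_, _, _, _) => /=; ring.
Qed.

Lemma qmulBl x y z : qmul (y - z) x = qmul y x - qmul z x.
Proof.
by case: x y z => [[[? ?] ?] ?] [[[? ?] ?] ?] [[[? ?] ?] ?]; congr (_, _, _, _) => /=; ring.
Qed.

Lemma qmulZl r x y : qmul (qscale r x) y = qscale r (qmul x y).
Proof.
by case: x y => [[[? ?] ?] ?] [[[? ?] ?] ?]; congr (_, _, _, _) => /=; ring.
Qed.

Lemma qmulZr r x y : qmul x (qscale r y) = qscale r (qmul x y).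
Proof.
by case: x y => [[[? ?] ?] ?] [[[? ?] ?] ?]; congr (_, _, _, _) => /=; ring.
Qed.

Lemma qscaleA r1 r2 x : qscale r1 (qscale r2 x) = qscale (r1 * r2) x.
Proof. by case: x => [[[? ?] ?] ?]; congr (_, _, _, _) => /=; ring. Qed.

Lemma qscaleDl r1 r2 x : qscale (r1 + r2) x = qscale r1 x + qscale r2 x.
Proof. by case: x => [[[? ?] ?] ?]; congr (_, _, _, _) => /=; ring. Qed.

Lemma qscaleN r x : qscale (- r) x = - qscale r x.
Proof. by case: x => [[[? ?] ?] ?]; congr (_, _, _, _) => /=; ring. Qed.

Lemma qscale0 x : qscale 0 x = 0.
Proof. by case: x => [[[? ?] ?] ?]; congr (_, _, _, _) => /=; ring. Qed.

Lemma qscale1 x : qscale 1 x = x.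
Proof. by case: x => [[[? ?] ?] ?]; congr (_, _, _, _) => /=; ring. Qed.

Lemma qscaler0 r : qscale r 0 = 0.
Proof. by congr (_, _, _, _) => /=; ring. Qed.

Lemma qconjK x : qconj (qconj x) = x.
Proof. by case: x => [[[? ?] ?] ?]; congr (_, _, _, _) => /=; ring. Qed.

Lemma qconjM x y : qconj (qmul x y) = qmul (qconj y) (qconj x).
Proof.
by case: x y => [[[? ?] ?] ?] [[[? ?] ?] ?]; congr (_, _, _, _) => /=; ring.
Qed.

Lemma qconjB x y : qconj (x - y) = qconj x - qconj y.
Proof.
by case: x y => [[[? ?] ?] ?] [[[? ?] ?] ?]; congr (_, _, _, _) => /=; ring.
Qed.

Lemma qconj0 : qconj 0 = 0.
Proof. by congr (_, _, _, _) => /=; ring. Qed.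

Lemma qnormM x y : qnorm (qmul x y) = qnorm x * qnorm y.
Proof. by case: x y => [[[? ?] ?] ?] [[[? ?] ?] ?] /=; ring. Qed.

Lemma qnorm_conj x : qnorm (qconj x) = qnorm x.
Proof. by case: x => [[[? ?] ?] ?] /=; ring. Qed.

Lemma qnormZ r x : qnorm (qscale r x) = r ^+ 2 * qnorm x.
Proof. by case: x => [[[? ?] ?] ?] /=; ring. Qed.

Lemma qmul_conj x y : qmul x (qmul (qconj x) y) = qscale (qnorm x) y.
Proof.
by case: x y => [[[? ?] ?] ?] [[[? ?] ?] ?]; congr (_, _, _, _) => /=; ring.
Qed.

Lemma qconj_mul x y : qmul (qconj x) (qmul x y) = qscale (qnorm x) y.
Proof. by rewrite -{2}(qconjK x) qmul_conj qnorm_conj. Qed.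

Lemma qmul_conjr x y : qmul (qmul y x) (qconj x) = qscale (qnorm x) y.
Proof.
by case: x y => [[[? ?] ?] ?] [[[? ?] ?] ?]; congr (_, _, _, _) => /=; ring.
Qed.

Lemma qmulqconj x : qmul x (qconj x) = (qnorm x, 0, 0, 0).
Proof. by case: x => [[[? ?] ?] ?]; congr (_, _, _, _) => /=; ring. Qed.

Lemma qmulconjq x : qmul (qconj x) x = (qnorm x, 0, 0, 0).
Proof. by case: x => [[[? ?] ?] ?]; congr (_, _, _, _) => /=; ring. Qed.

Lemma qtrC x y : qtr (qmul x y) = qtr (qmul y x).
Proof. by case: x y => [[[? ?] ?] ?] [[[? ?] ?] ?]; rewrite /qtr /qre /=; ring. Qed.

Lemma qtr_pure x : qre x = 0 -> qtr x = 0.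
Proof. by rewrite /qtr => ->; rewrite mul0rn. Qed.

Lemma qmul_pure x : qre x = 0 -> qmul x x = (- qnorm x, 0, 0, 0).
Proof. by case: x => [[[? ?] ?] ?]; rewrite /qre /= => ->; congr (_, _, _, _) => /=; ring. Qed.

Lemma qre_sandwich a x : qre (qmul (qmul a x) (qconj a)) = qnorm a * qre x.
Proof. by case: a x => [[[? ?] ?] ?] [[[? ?] ?] ?]; rewrite /qre /=; ring. Qed.

Lemma qmul_sandwich a x : qmul (qmul a x) a = qscale (qtr (qmul a x)) a - qscale (qnorm a) (qconj x).
Proof.
by case: a x => [[[? ?] ?] ?] [[[? ?] ?] ?]; rewrite /qtr /qre; congr (_, _, _, _) => /=; ring.
Qed.

Lemma qtrD_conj x y : qmul x (qconj y) + qmul y (qconj x) = (qtr (qmul x (qconj y)), 0, 0, 0).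
Proof.
by case: x y => [[[? ?] ?] ?] [[[? ?] ?] ?]; rewrite /qtr /qre; congr (_, _, _, _) => /=; ring.
Qed.

Lemma qmul_real r x : qmul (r, 0, 0, 0) x = qscale r x.
Proof. by case: x => [[[? ?] ?] ?]; congr (_, _, _, _) => /=; ring. Qed.

Lemma qmul_realr r x : qmul x (r, 0, 0, 0) = qscale r x.
Proof. by case: x => [[[? ?] ?] ?]; congr (_, _, _, _) => /=; ring. Qed.

Lemma qre_average x : x - qmul (qmul (0, 1, 0, 0) x) (0, 1, 0, 0)
  - qmul (qmul (0, 0, 1, 0) x) (0, 0, 1, 0) - qmul (qmul (0, 0, 0, 1) x) (0, 0, 0, 1)
  = (qre x *+ 4, 0, 0, 0).
Proof. by case: x => [[[? ?] ?] ?]; rewrite /qre; congr (_, _, _, _) => /=; ring. Qed.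

End QuaternionAlgebra.

(** * Null quaternions over a field of characteristic other than 2 *)

Section QuaternionField.
Variable F : fieldType.
Hypothesis two_neq0 : (2 : F) != 0.
Implicit Types (x y z a b c d s w : quat F) (r : F).

Lemma qscale_eq0 r x : qscale r x = 0 -> r != 0 -> x = 0.
Proof.
case: x => [[[x0 x1] x2] x3] [] h0 h1 h2 h3 rn0.
by move/eqP: h0; move/eqP: h1; move/eqP: h2; move/eqP: h3; rewrite !mulf_eq0 (negbTE rn0) /=
  => /eqP-> /eqP-> /eqP-> /eqP->.
Qed.

(** The trace form is diagonal in the basis 1, i, j, k, with entries 2, -2, -2, -2, so one of these
    four elements detects a nonzero coordinate. *)
Lemma qtr_nondegenerate x : x != 0 -> exists s, qtr (qmul x s) != 0.
Proof.
move=> xn0.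
suff [s hs] : exists s, qre (qmul x s) != 0.
  by exists s; rewrite /qtr -mulr_natr mulf_neq0.
case: x xn0 => [[[x0 x1] x2] x3].
have [->|h0 _] := eqVneq x0 0; last first.
  exists (1, 0, 0, 0).
  have -> : qre (qmul (x0, x1, x2, x3) (1, 0, 0, 0)) = x0 by rewrite /qre /=; ring.
  by [].
have [->|h0 _] := eqVneq x1 0; last first.
  exists (0, 1, 0, 0).
  have -> : qre (qmul (0, x1, x2, x3) (0, 1, 0, 0)) = - x1 by rewrite /qre /=; ring.
  by rewrite oppr_eq0.
have [->|h0 _] := eqVneq x2 0; last first.
  exists (0, 0, 1, 0).
  have -> : qre (qmul (0, 0, x2, x3) (0, 0, 1, 0)) = - x2 by rewrite /qre /=; ring.
  by rewrite oppr_eq0.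
have [->|h0 _] := eqVneq x3 0; last first.
  exists (0, 0, 0, 1).
  have -> : qre (qmul (0, 0, 0, x3) (0, 0, 0, 1)) = - x3 by rewrite /qre /=; ring.
  by rewrite oppr_eq0.
by rewrite eqxx.
Qed.

(* The sum of e y e^-1 over e = 1, i, j, k is 4 Re y. *)
Lemma quat_prime c x : (forall s, qmul (qmul c s) x = 0) -> x != 0 -> c = 0.
Proof.
move=> h /qtr_nondegenerate [s hs].
have hc e f : qmul c (qmul (qmul e (qmul x s)) f) = 0.
  by rewrite !qmulA h !qmul0q.
have : qmul c (qre (qmul x s) *+ 4, 0, 0, 0) = 0.
  have h1 : qmul c (qmul x s) = 0.
    by have := h (1, 0, 0, 0); rewrite qmul_realr qscale1 qmulA => ->; rewrite qmul0q.
  by rewrite -qre_average !qmulBr !hc h1 !subr0.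
rewrite qmul_realr => /qscale_eq0 -> //.
have -> : qre (qmul x s) *+ 4 = qtr (qmul x s) * 2 by rewrite /qtr; ring.
by rewrite mulf_neq0.
Qed.

(* [c x = 0] turns [x s + conj s conj x = tr (x s)] into [c conj s conj x = tr (x s) c],
   which [conj d] kills on the right. *)
Lemma annihilators_proportional c d x :
  qmul c x = 0 -> qmul d x = 0 -> x != 0 -> qmul c (qconj d) = 0.
Proof.
move=> cx dx /qtr_nondegenerate [s hs].
apply: (@qscale_eq0 (qtr (qmul x s))) => //.
have E : qmul c (qmul (qconj s) (qconj x)) = qscale (qtr (qmul x s)) c.
  have := qtrD_conj x (qconj s); rewrite qconjK => /(congr1 (qmul c)).
  rewrite qmul_realr => <-.
  have -> (u v w : quat F) : qmul u (v + w) = qmul u v + qmul u w.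
    by rewrite -{1}(opprK w) qmulBr -{1}(sub0r w) qmulBr qmulq0 sub0r opprK.
  by rewrite (qmulA c x) cx qmul0q add0r.
rewrite -qmulZl -E -!qmulA -qconjM dx.
by rewrite qconj0 !qmulq0.
Qed.

(* For [p = c s] with [tr p <> 0], [conj p w p = 0] and [p w p = tr (p w) p] give
   [tr p (w p) = tr (p w) p]; multiply by [w] once more and use [w^2 = - n]. *)
Lemma sandwich_square c w n : qre w = 0 -> qnorm w = n -> c != 0 -> qnorm c = 0 ->
  qmul (qmul (qconj c) w) c = 0 -> exists r, r ^+ 2 = - n.
Proof.
move=> wr wn cn0 nc0 h; have [s hs] := qtr_nondegenerate cn0.
set p := qmul c s; set T := qtr p; set B := qtr (qmul p w).
have np : qnorm p = 0 by rewrite qnormM nc0 mul0r.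
have hp : qmul (qmul (qconj p) w) p = 0.
  by rewrite /p qconjM -!qmulA (qmulA w) (qmulA (qconj c)) (qmulA (qconj c)) h qmul0q qmulq0.
have pwp : qmul (qmul p w) p = qscale B p.
  by rewrite qmul_sandwich np qscale0 subr0.
have TB : qscale T (qmul w p) = qscale B p.
  rewrite -pwp -(addr0 (qmul (qmul p w) p)) -hp.
  have -> (x y z : quat F) : qmul (qmul x y) z + qmul (qmul (qconj x) y) z = qscale (qtr x) (qmul y z).
    by case: x y z => [[[? ?] ?] ?] [[[? ?] ?] ?] [[[? ?] ?] ?];
       rewrite /qtr /qre; congr (_, _, _, _) => /=; ring.
  by [].
have pn0 : p != 0 by apply: contraNneq hs => hp0; rewrite -/p hp0 /qtr /qre /= mul0rn.
have E : qscale (T ^+ 2 * - n) p = qscale (B ^+ 2) p.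
  rewrite -qscaleA.
  have -> : qscale (- n) p = qmul w (qmul w p) by rewrite qmulA qmul_pure // wn qmul_real.
  rewrite expr2 -qscaleA -(qmulZr T w) TB qmulZr qscaleA mulrC -qscaleA TB.
  by rewrite qscaleA expr2.
have : T ^+ 2 * - n = B ^+ 2.
  apply/eqP; rewrite -subr_eq0; apply: contraNT pn0 => hn; apply/eqP.
  by apply: (qscale_eq0 _ hn); rewrite qscaleDl qscaleN E subrr.
move=> hTB; exists (B / T); rewrite expr_div_n -hTB mulrC mulKf //.
by rewrite expf_neq0.
Qed.

(* With [g = b a] and [w = a b], sandwiching gives [g s w = tr (a s) b a b = tr (a s) tr (b a) b = 0]. *)
Lemma swap_null_factors a b : qnorm a = 0 -> qnorm b = 0 ->
  qre (qmul a b) = 0 -> qmul a b != 0 -> qmul b a = 0.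
Proof.
move=> na nb trab abn0; apply: (quat_prime _ abn0) => s.
have -> : qmul (qmul (qmul b a) s) (qmul a b) = qmul (qmul b (qmul (qmul a s) a)) b.
  by rewrite !qmulA.
rewrite (qmul_sandwich a s) na qscale0 subr0 qmulZr qmulZl qmul_sandwich nb (qtrC b a) (qtr_pure trab).
by rewrite !qscale0 subr0 qscaler0.
Qed.

End QuaternionField.

(** * Change of coefficients and integral quaternions *)

Definition qmap (R S : Type) (f : R -> S) (x : quat R) : quat S :=
  let: (x0, x1, x2, x3) := x in (f x0, f x1, f x2, f x3).

Lemma qmap_mul (R S : comNzRingType) (f : {rmorphism R -> S}) (x y : quat R) :
  qmap f (qmul x y) = qmul (qmap f x) (qmap f y).
Proof.
case: x y => [[[? ?] ?] ?] [[[? ?] ?] ?]; congr (_, _, _, _);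
by rewrite !(rmorphD, rmorphN, rmorphM).
Qed.

Lemma qmap_conj (R S : comNzRingType) (f : {rmorphism R -> S}) (x : quat R) :
  qmap f (qconj x) = qconj (qmap f x).
Proof. by case: x => [[[? ?] ?] ?]; congr (_, _, _, _); rewrite rmorphN. Qed.

Lemma qmap_norm (R S : comNzRingType) (f : {rmorphism R -> S}) (x : quat R) :
  qnorm (qmap f x) = f (qnorm x).
Proof. by case: x => [[[? ?] ?] ?]; rewrite /= !(rmorphD, rmorphXn). Qed.

Lemma qmap_re (R S : comNzRingType) (f : {rmorphism R -> S}) (x : quat R) :
  qre (qmap f x) = f (qre x).
Proof. by case: x => [[[? ?] ?] ?]. Qed.

Lemma qmapB (R S : comNzRingType) (f : {rmorphism R -> S}) (x y : quat R) :
  qmap f (x - y) = qmap f x - qmap f y.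
Proof. by case: x y => [[[? ?] ?] ?] [[[? ?] ?] ?]; congr (_, _, _, _); apply: rmorphB. Qed.

Lemma qmapZ (R S : comNzRingType) (f : {rmorphism R -> S}) r (x : quat R) :
  qmap f (qscale r x) = qscale (f r) (qmap f x).
Proof. by case: x => [[[? ?] ?] ?]; congr (_, _, _, _); apply: rmorphM. Qed.

Lemma qnorm_ge0 (x : quat int) : 0 <= qnorm x.
Proof. by case: x => [[[? ?] ?] ?]; rewrite /= !addr_ge0 // sqr_ge0. Qed.

Lemma qnorm_eq0 (x : quat int) : qnorm x = 0 -> x = 0.
Proof.
case: x => [[[x0 x1] x2] x3] /= h.
have e0 : x0 = 0 by nia. have e1 : x1 = 0 by nia.
have e2 : x2 = 0 by nia. have e3 : x3 = 0 by nia.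
by rewrite e0 e1 e2 e3.
Qed.

Lemma qscale_inj (m : int) (x y : quat int) : m != 0 -> qscale m x = qscale m y -> x = y.
Proof.
case: x y => [[[? ?] ?] ?] [[[? ?] ?] ?] m0 [].
by do 4 move/(mulfI m0)->.
Qed.

(** Division with centred remainder. For even [m] the bound can be attained, which is the delicate
    case of the descent. *)
Lemma rounding (m : nat) (z : int) : (0 < m)%N -> exists t r : int, z = m%:Z * t + r /\ `|2 * r| <= m%:Z.
Proof.
move=> m0; exists ((2 * z + m%:Z) %/ (2 * m%:Z))%Z.
exists (z - m%:Z * ((2 * z + m%:Z) %/ (2 * m%:Z))%Z); split; first by ring.
have := divz_eq (2 * z + m%:Z) (2 * m%:Z).
have r_ge0 : 0 <= ((2 * z + m%:Z) %% (2 * m%:Z))%Z by apply: modz_ge0; lia.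
have : ((2 * z + m%:Z) %% (2 * m%:Z))%Z < 2 * m%:Z by apply: ltz_pmod; lia.
move: r_ge0; move: (_ %/ _)%Z (_ %% _)%Z => q r r_ge0 r_lt E.
have -> : 2 * (z - m%:Z * q) = r - m%:Z by apply: (addIr (m%:Z + 2 * (m%:Z * q))); lia.
lia.
Qed.

Lemma qrounding (m : nat) (x : quat int) : (0 < m)%N -> exists t z : quat int,
  [/\ x = qscale m%:Z t + z, `|2 * z.1.1.1| <= m%:Z, `|2 * z.1.1.2| <= m%:Z,
   `|2 * z.1.2| <= m%:Z & `|2 * z.2| <= m%:Z].
Proof.
case: x => [[[x0 x1] x2] x3] m0.
have [t0 [z0 [e0 h0]]] := rounding x0 m0; have [t1 [z1 [e1 h1]]] := rounding x1 m0.
have [t2 [z2 [e2 h2]]] := rounding x2 m0; have [t3 [z3 [e3 h3]]] := rounding x3 m0.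
by exists (t0, t1, t2, t3), (z0, z1, z2, z3); split=> //=; rewrite e0 e1 e2 e3.
Qed.

(** * Lagrange's descent to a left factor of prime norm *)

Section ModPrime.
Variable l : nat.
Hypotheses (l_prime : prime l) (l_odd : odd l).

Definition qred : quat int -> quat 'F_l := qmap intr.

Lemma intr_Fp_eq0 (z : int) : (z%:~R == 0 :> 'F_l) = (l %| z)%Z.
Proof. by rewrite (dvdz_pcharf (pchar_Fp l_prime)). Qed.

Lemma Fp_two_neq0 : (2 : 'F_l) != 0.
Proof.
rewrite -[2]/((2%:Z)%:~R) intr_Fp_eq0; apply/negP => h.
have : (l %| 2)%N by exact: h.
by rewrite dvdn_prime2 // => /eqP l2; move: l_odd; rewrite l2.
Qed.

Lemma qredP (x : quat int) : qred x = 0 <-> exists y, x = qscale l%:Z y.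
Proof.
split; last first.
  move=> [y ->]; rewrite /qred qmapZ /= -pmulrn pchar_Fp_0 //.
  exact: qscale0.
case: x => [[[x0 x1] x2] x3] [] /eqP h0 /eqP h1 /eqP h2 /eqP h3.
move: h0 h1 h2 h3; rewrite !intr_Fp_eq0.
move=> /dvdzP [y0 ->] /dvdzP [y1 ->] /dvdzP [y2 ->] /dvdzP [y3 ->].
by exists (y0, y1, y2, y3); rewrite /= !(mulrC l%:Z).
Qed.

Lemma prime_no_factor (m : nat) (c : int) : (1 < m < l)%N -> l%:Z = m%:Z * c -> False.
Proof.
move=> /andP [m1 ml] h.
have : (m %| l)%N by change (m%:Z %| l%:Z)%Z; rewrite h dvdz_mulr.
by case/primeP: l_prime => _ p /p /orP [] /eqP; lia.
Qed.

(* One step of Lagrange's descent: from [y] of norm [m l] left-annihilating [x] mod [l], round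
   [conj y = m t + z]; then [l - y t = y z / m] has norm [l N(z) / m]. *)
Lemma descent_step (m : nat) (x y : quat int) : (1 < m < l)%N ->
  qnorm y = m%:Z * l%:Z -> qmul (qconj (qred y)) (qred x) = 0 ->
  exists m' y', [/\ (0 < m' < m)%N, qnorm y' = m'%:Z * l%:Z
    & qmul (qconj (qred y')) (qred x) = 0].
Proof.
move=> ml ny hy; have /andP [m1 _] := ml.
have [t [z [E h0 h1 h2 h3]]] := qrounding (qconj y) (ltnW m1).
have m0 : m%:Z != 0 by lia.
(* Modulo [m] the remainder [z] is [conj y], whose norm is [m l]. *)
have [e he] : exists e : int, qnorm z = m%:Z * e.
  have : qnorm (qconj y) = m%:Z * l%:Z by rewrite qnorm_conj.
  rewrite E; case: (t) (z) => [[[t0 t1] t2] t3] [[[z0 z1] z2] z3] /= h.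
  exists (l%:Z - m%:Z * (t0 ^+ 2 + t1 ^+ 2 + t2 ^+ 2 + t3 ^+ 2)
     - 2 * (t0 * z0 + t1 * z1 + t2 * z2 + t3 * z3)).
  by rewrite !mulrBr -h; ring.
pose y' := (l%:Z, 0, 0, 0) - qmul y t.
have yz : qmul y z = qscale m%:Z y'.
  have : z = qconj y - qscale m%:Z t by rewrite E addrAC subrr add0r.
  move=> ->; rewrite qmulBr qmulqconj qmulZr ny /y'.
  by case: (qmul y t) => [[[? ?] ?] ?]; congr (_, _, _, _) => /=; ring.
have ny' : qnorm y' = e * l%:Z.
  have := congr1 (@qnorm _) yz; rewrite qnormM qnormZ ny he => h.
  by apply: (mulfI (mulf_neq0 m0 m0)); rewrite -expr2 -h; ring.
have e_ge0 : 0 <= e by have := qnorm_ge0 z; rewrite he; nia.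
(* If [z = 0] then [conj y = m t], so [m^2] divides [m l], impossible for [l] prime. *)
have e_neq0 : e != 0.
  apply/eqP => e0; have z0 : z = 0 by apply: qnorm_eq0; rewrite he e0 mulr0.
  have := congr1 (@qnorm _) E; rewrite z0 addr0 qnormZ qnorm_conj ny expr2 -mulrA.
  by move/(mulfI m0) => /(prime_no_factor ml).
have e_le : e <= m%:Z.
  suff : 4 * (m%:Z * e) <= 4 * (m%:Z * m%:Z) by nia.
  rewrite -he; case: (z) h0 h1 h2 h3 => [[[z0 z1] z2] z3] /=; nia.
(* Equality forces every coordinate of [z] to be [m]/2 up to sign; then [m^2] divides N([m t + z]) =
   [m l], again impossible. *)
have e_neq : e != m%:Z.
  apply/eqP => em.
  have sq (a : int) : `|2 * a| <= m%:Z -> 4 * a ^+ 2 <= m%:Z ^+ 2 by nia.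
  have half (a : int) : 4 * a ^+ 2 = m%:Z ^+ 2 -> exists s : int, 2 * a = m%:Z * s.
    move=> ha; have : (2 * a - m%:Z) * (2 * a + m%:Z) = 0 by nia.
    move/eqP; rewrite mulf_eq0 => /orP [] /eqP ?; [exists 1 | exists (-1)]; lia.
  move: he; rewrite em => hz.
  have := congr1 (@qnorm _) E; rewrite qnorm_conj ny.
  case: (t) (z) h0 h1 h2 h3 hz => [[[t0 t1] t2] t3] [[[z0 z1] z2] z3].
  move=> /sq h0 /sq h1 /sq h2 /sq h3 hz; rewrite /= in h0 h1 h2 h3 hz.
  have [s0 e0] : exists s : int, 2 * z0 = m%:Z * s by apply: half; lia.
  have [s1 e1] : exists s : int, 2 * z1 = m%:Z * s by apply: half; lia.
  have [s2 e2] : exists s : int, 2 * z2 = m%:Z * s by apply: half; lia.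
  have [s3 e3] : exists s : int, 2 * z3 = m%:Z * s by apply: half; lia.
  move=> /= h; apply: (prime_no_factor ml (c := t0 ^+ 2 + t1 ^+ 2 + t2 ^+ 2 + t3 ^+ 2
     + (t0 * s0 + t1 * s1 + t2 * s2 + t3 * s3) + 1)).
  apply: (mulfI m0); rewrite h.
  have hts : m%:Z * (t0 * s0 + t1 * s1 + t2 * s2 + t3 * s3)
    = t0 * (2 * z0) + t1 * (2 * z1) + t2 * (2 * z2) + t3 * (2 * z3) by rewrite e0 e1 e2 e3; ring.
  rewrite [in RHS]mulrDr [in RHS](mulrDr m%:Z _ (_ + t3 * s3)) mulr1 hts.
  by rewrite [in RHS]mulrDr -[in RHS]hz; ring.
exists `|e|%N, y'; split; first by lia.
  by rewrite ny'; congr (_ * _); lia.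
rewrite /qred qmapB qmap_mul -/qred.
have -> : qred (l%:Z, 0, 0, 0) = 0.
  by apply/qredP; exists (1, 0, 0, 0); congr (_, _, _, _); rewrite ?mulr1 ?mulr0.
by rewrite qconjB qconj0 qmulBl qmul0q sub0r qconjM -qmulA hy qmulq0 oppr0.
Qed.

(** Centred reduction modulo [l] replaces [x] by [y] with N([y]) = [m l]; here [m < l], because for
    odd [l] the coordinates are strictly below [l]/2. The descent then runs from [y] until
    [m = 1]. *)
Lemma prime_norm_left_factor (x : quat int) : qnorm (qred x) = 0 -> qred x != 0 ->
  exists a, qnorm a = l%:Z /\ qmul (qconj (qred a)) (qred x) = 0.
Proof.
move=> nx xn0.
have descent m : forall y, (0 < m < l)%N -> qnorm y = m%:Z * l%:Z ->
    qmul (qconj (qred y)) (qred x) = 0 ->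
    exists a, qnorm a = l%:Z /\ qmul (qconj (qred a)) (qred x) = 0.
  elim/ltn_ind: m => m IH y ml ny hy; have [m1|m1] := leqP m 1.
    by exists y; split=> //; rewrite ny (_ : m = 1%N) ?mul1r //; lia.
  have [|m' [y' [m'm ny' hy']]] := @descent_step m x y _ ny hy; first lia.
  by apply: (IH m' _ y') => //; lia.
have l0 := prime_gt0 l_prime.
have [t [y [E h0 h1 h2 h3]]] := qrounding x l0.
have xy : qred x = qred y.
  have : y = x - qscale l%:Z t by rewrite E addrAC subrr add0r.
  have ht : qred (qscale l%:Z t) = 0 by apply/qredP; exists t.
  by move=> ->; rewrite /qred qmapB [X in _ - X]ht subr0.
have : (l%:Z %| qnorm y)%Z by rewrite -intr_Fp_eq0 -qmap_norm -/qred -xy nx.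
case/dvdzP => m hm.
have yn0 : y != 0.
  apply: contraNneq xn0 => y0; rewrite xy y0; apply/eqP/qredP; exists 0.
  by rewrite qscaler0.
have ny0 : qnorm y != 0 by apply: contraNneq yn0 => /qnorm_eq0 ->.
have y_ge := qnorm_ge0 y.
have ylt : qnorm y < l%:Z * l%:Z.
  have odd_lt (a : int) : `|2 * a| <= l%:Z -> 4 * a ^+ 2 < l%:Z * l%:Z.
    move=> h; suff : `|2 * a| < l%:Z by nia.
    suff : `|2 * a| != l%:Z by lia.
    by apply/eqP => ha; have : l = (`|a|%N).*2 by [lia]; move: l_odd => /[swap] ->; rewrite odd_double.
  case: (y) h0 h1 h2 h3 => [[[? ?] ?] ?] /= /odd_lt h0 /odd_lt h1 /odd_lt h2 /odd_lt h3; lia.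
apply: (descent `|m|%N y); first by nia.
  by rewrite hm; congr (_ * _); nia.
by rewrite -xy qmulconjq nx.
Qed.

End ModPrime.

(** * Enumeration of integral quaternions of given norm *)

Definition int_ball (K : nat) : seq int := [seq i%:Z - K%:Z | i <- iota 0 K.*2.+1].

Lemma mem_int_ball K (z : int) : (z \in int_ball K) = (`|z| <= K%:Z).
Proof.
apply/mapP/idP => [[i]|h]; first by rewrite mem_iota => hi ->; lia.
by exists (absz (z + K%:Z)); [rewrite mem_iota | ]; lia.
Qed.

Lemma int_ball_uniq K : uniq (int_ball K).
Proof. by rewrite map_inj_uniq ?iota_uniq // => i j; lia. Qed.

(** Sums over a product box split into one-variable sums, which later relates norms to powers of
    theta. *)
Definition quat_box (K : nat) : seq (quat int) :=
  let r := int_ball K in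
  [seq (x, d) | x <- [seq (y, c) | y <- [seq (a, b) | a <- r, b <- r], c <- r], d <- r].

Lemma mem_allpairs_pair (S T : eqType) (s : seq S) (t : seq T) x y :
  ((x, y) \in [seq (x, y) | x <- s, y <- t]) = (x \in s) && (y \in t).
Proof.
apply/allpairsP/andP => [[[x' y'] /= [hx hy [-> ->]]] //|[hx hy]].
by exists (x, y).
Qed.

Lemma quat_box_uniq K : uniq (quat_box K).
Proof. by do !apply: allpairs_uniq; rewrite ?int_ball_uniq // => -[? ?] [? ?]. Qed.

Definition qnormset (n : nat) : seq (quat int) := [seq x <- quat_box n | qnorm x == n%:Z].

Lemma mem_quat_box_norm (n K : nat) x : (n <= K)%N -> qnorm x = n%:Z -> x \in quat_box K.
Proof.
case: x => [[[x0 x1] x2] x3] /= nK h.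
rewrite /quat_box !mem_allpairs_pair !mem_int_ball.
have sq (z s : int) : 0 <= s -> z ^+ 2 + s = n%:Z -> `|z| <= K%:Z by nia.
rewrite (sq x0 (x1 ^+ 2 + x2 ^+ 2 + x3 ^+ 2)) ?addr_ge0 ?sqr_ge0 //; last by rewrite -h; ring.
rewrite (sq x1 (x0 ^+ 2 + x2 ^+ 2 + x3 ^+ 2)) ?addr_ge0 ?sqr_ge0 //; last by rewrite -h; ring.
rewrite (sq x2 (x1 ^+ 2 + x0 ^+ 2 + x3 ^+ 2)) ?addr_ge0 ?sqr_ge0 //; last by rewrite -h; ring.
by rewrite (sq x3 (x1 ^+ 2 + x2 ^+ 2 + x0 ^+ 2)) ?addr_ge0 ?sqr_ge0 //; last by rewrite -h; ring.
Qed.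

Lemma mem_qnormset n x : (x \in qnormset n) = (qnorm x == n%:Z).
Proof.
rewrite mem_filter; case: eqP => //= h; exact: (mem_quat_box_norm (leqnn n)).
Qed.

Lemma qnormset_uniq n : uniq (qnormset n).
Proof. by rewrite filter_uniq ?quat_box_uniq. Qed.

Lemma size_qnormset1 : size (qnormset 1) = 8%N.
Proof. by vm_compute. Qed.

Definition r4 n := size (qnormset n).
(* Sums of three squares are norms of quaternions with real part 0. *)
Definition r3 n := count (fun x => qre x == 0) (qnormset n).

(** * Bijections, double counting and sums of two squares modulo a prime *)

Lemma eq_count_bij (T U : eqType) (s : seq T) (t : seq U) (p : pred T) (q : pred U)
    (f : T -> U) (g : U -> T) : uniq s -> uniq t ->
  (forall x, x \in s -> p x -> [/\ f x \in t, q (f x) & g (f x) = x]) ->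
  (forall y, y \in t -> q y -> [/\ g y \in s, p (g y) & f (g y) = y]) ->
  count p s = count q t.
Proof.
move=> us ut hf hg; rewrite -!size_filter -(size_map f); apply: perm_size.
apply: uniq_perm; last 1 first.
- move=> y; rewrite mem_filter; apply/mapP/andP.
    by move=> [x]; rewrite mem_filter => /andP [px xs] ->; have [] := hf x xs px.
  move=> [qy yt]; have [gs pg e] := hg y yt qy.
  by exists (g y); rewrite ?mem_filter ?pg.
- rewrite map_inj_in_uniq ?filter_uniq // => x x'.
  rewrite !mem_filter => /andP [px xs] /andP [px' xs'] e.
  have [_ _ <-] := hf x xs px; have [_ _ <-] := hf x' xs' px'.
  by rewrite e.
- exact: filter_uniq.
Qed.

Lemma exchange_count (T U : eqType) (s : seq T) (t : seq U) (r : T -> U -> bool) :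
  (\sum_(x <- s) count (r x) t = \sum_(y <- t) count (r^~ y) s)%N.
Proof.
under eq_bigr => x _ do rewrite -sum1_count big_mkcond.
rewrite exchange_big /=; apply: eq_bigr => y _.
by rewrite -big_mkcond sum1_count.
Qed.

(** Pigeonhole: the set [S] of squares and the set -1 - [S] both have more than [l]/2 elements, so
    they meet. *)
Lemma Fp_sum_two_squares (l : nat) : prime l -> odd l ->
  exists a b : 'F_l, a ^+ 2 + b ^+ 2 = -1.
Proof.
move=> pl ol; pose S := [set x ^+ 2 | x : 'F_l]; pose T := [set -1 - y | y in S].
have cT : #|T| = #|S| by apply: card_imset => x y /addrI /oppr_inj.
have cS : (l <= #|S| * 2)%N.
  rewrite -{1}(card_Fp pl) -cardsT -card_bool -cardsT -cardsX.
  (* A surjection from [S] times two signs: a chosen square root or its negative. On [S] the default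
     0 is never reached. *)
  pose f (p : 'F_l * bool) : 'F_l :=
    let r := odflt 0 [pick x | x ^+ 2 == p.1] in if p.2 then r else - r.
  apply: leq_trans (leq_imset_card f _); apply: subset_leq_card.
  apply/subsetP => x _; apply/imsetP.
  have xS : x ^+ 2 \in S by apply: imset_f.
  have [y hy yP] : exists2 y : 'F_l, (if [pick y | y ^+ 2 == x ^+ 2] is Some y then y else 0) = y
      & y ^+ 2 == x ^+ 2.
    by case: pickP => [y|/(_ x)]; [exists y | rewrite eqxx].
  have /orP [/eqP ->|/eqP ->] : (x == y) || (x == - y) by rewrite -eqf_sqr eq_sym.
  - exists (x ^+ 2, true); first by rewrite in_setX xS inE.
    by rewrite /f /= -{1}hy; case: pickP.
  - exists (x ^+ 2, false); first by rewrite in_setX xS inE.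
    by rewrite /f /= -{1}hy; case: pickP.
have : (#|S :&: T| > 0)%N.
  have := cardsUI S T; rewrite cT.
  have : (#|S :|: T| <= l)%N by apply: leq_trans (max_card _) _; rewrite card_Fp.
  have := odd_double_half l; rewrite ol => hl.
  move: cS hl; rewrite -!muln2; move: #|S| #|S :|: T| #|S :&: T| (l./2) => *; lia.
case/card_gt0P => y; rewrite inE => /andP [/imsetP [a _ ->] /imsetP [_ /imsetP [b _ ->] h]].
by exists a, b; rewrite h subrK.
Qed.

(* Meaningful only on multiples of [m]: the division is componentwise and rounds down. *)
Definition qdiv (m : int) : quat int -> quat int := qmap (fun z => (z %/ m)%Z).

Lemma qdivK m y : m != 0 -> qdiv m (qscale m y) = y.
Proof. by case: y => [[[? ?] ?] ?] m0; rewrite /= !(mulrC m) !mulzK. Qed.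

(** * Left factors of norm [l] and the isotropic plane modulo [l] *)

Section HeckeRelations.
Variable l : nat.
Hypotheses (l_prime : prime l) (l_odd : odd l).
Local Notation red := (qred l).
Local Notation A := (qnormset l).

(** For [a] of norm [l], where [a conj a = l], this says that [a] divides every lift of [x] on the
    left. *)
Definition left_annihilates (a : quat int) (x : quat 'F_l) := qmul (qconj (red a)) x == 0.

Let l_neq0 : l%:Z != 0. Proof. by rewrite eqz_nat -lt0n prime_gt0. Qed.

Lemma qred_surj (x : quat 'F_l) : exists y, red y = x.
Proof.
have lift (z : 'F_l) : exists n : int, n%:~R = z.
  by exists (val z)%:Z; rewrite -pmulrn natr_Zp.
case: x => [[[x0 x1] x2] x3].
have [[y0 <-] [y1 <-]] := (lift x0, lift x1); have [[y2 <-] [y3 <-]] := (lift x2, lift x3).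
by exists (y0, y1, y2, y3).
Qed.

Lemma qred_mul x y : red (qmul x y) = qmul (red x) (red y).
Proof. exact: qmap_mul. Qed.

Lemma qred_conj x : red (qconj x) = qconj (red x).
Proof. exact: qmap_conj. Qed.

Lemma qnorm_qred_A a : a \in A -> qnorm (red a) = 0.
Proof.
rewrite mem_qnormset => /eqP h; rewrite qmap_norm h; apply/eqP.
by rewrite intr_Fp_eq0 // dvdzz.
Qed.

Lemma qred_A_neq0 a : a \in A -> red a != 0.
Proof.
rewrite mem_qnormset => /eqP h; apply/eqP => /(qredP l_prime) [y hy].
move: h; rewrite hy qnormZ expr2 -mulrA -[RHS]mulr1 => /(mulfI l_neq0) h.
have : (l %| 1)%N by apply/(@dvdzP l%:Z 1); exists (qnorm y); rewrite mulrC h.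
by rewrite dvdn1 => /eqP l1; have := l_prime; rewrite l1.
Qed.

(** Descent gives one factor [a]. Any other [b] satisfies [conj a b = 0] modulo [l], hence [b = a u]
    with [u] one of the 8 units. *)
Lemma count_left_factors (x : quat 'F_l) : qnorm x = 0 -> x != 0 ->
  count (left_annihilates^~ x) A = 8%N.
Proof.
have [x' <-] := qred_surj x => nx xn0.
have [a [na ax]] := prime_norm_left_factor l_prime l_odd nx xn0.
rewrite -size_qnormset1 -(count_predT (qnormset 1)); symmetry.
pose g b : quat int := qdiv l (qmul (qconj a) b).
apply: (@eq_count_bij _ _ _ _ _ _ (qmul a) g); rewrite ?qnormset_uniq //.
  move=> u; rewrite !mem_qnormset => /eqP nu _; split.
  - by rewrite qnormM na nu mulr1.
  - by rewrite /left_annihilates qred_mul qconjM -qmulA ax qmulq0.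
  - by rewrite /g qconj_mul na qdivK.
move=> b; rewrite !mem_qnormset => /eqP nb /eqP bx.
have : red (qmul (qconj a) b) = 0.
  rewrite qred_mul qred_conj -(qconjK (red b)).
  by have := annihilators_proportional (Fp_two_neq0 l_prime l_odd) ax bx xn0.
case/(qredP l_prime) => u hu.
have nu : qnorm u = 1.
  have := congr1 (@qnorm _) hu; rewrite qnormM qnorm_conj na nb qnormZ -expr2.
  by rewrite -{1}[l%:Z ^+ 2]mulr1 => /(mulfI (expf_neq0 _ l_neq0)).
have gb : g b = u by rewrite /g hu qdivK.
split=> //; first by rewrite gb nu.
by apply: (qscale_inj l_neq0); rewrite gb -qmulZr -hu qmul_conj na.
Qed.

(** For [p = (s, t)] this is (s + t i)(1 + a j + b k), of norm (s^2 + t^2)(1 + a^2 + b^2). *)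
Definition isotropic_plane (a b : 'F_l) (p : 'F_l * 'F_l) : quat 'F_l :=
  (p.1, p.2, a * p.1 - b * p.2, b * p.1 + a * p.2).

(* The isotropic plane is the left ideal generated by [1 + a j + b k], so it meets
   the right ideal [{x | c x = 0}] in a line. *)
Lemma card_plane_kernel (a b : 'F_l) (c : quat 'F_l) :
  a ^+ 2 + b ^+ 2 = -1 -> qnorm c = 0 -> c != 0 ->
  #|[set p : 'F_l * 'F_l | (p != 0) && (qmul c (isotropic_plane a b p) == 0)]| = l.-1.
Proof.
move=> ab nc cn0; set P := isotropic_plane a b.
have two := Fp_two_neq0 l_prime l_odd.
(* Lets [ring] prove equalities that hold only modulo a^2 + b^2 = -1. *)
have mod_ab (x y k : 'F_l) : x - y = (a ^+ 2 + b ^+ 2 + 1) * k -> x = y.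
  by rewrite ab addNr mul0r => /eqP; rewrite subr_eq0 => /eqP.
have left_ideal (z : quat 'F_l) p : exists p', qmul z (P p) = P p'.
  case: z p => [[[z0 z1] z2] z3] [s t].
  exists (z0 * s - z1 * t - z2 * (a * s - b * t) - z3 * (b * s + a * t),
      z0 * t + z1 * s + z2 * (b * s + a * t) - z3 * (a * s - b * t)).
  rewrite /P /isotropic_plane /=; congr (_, _, _, _) => //.
    by apply: (mod_ab _ _ (z2 * s + z3 * t)); ring.
  by apply: (mod_ab _ _ (z3 * s - z2 * t)); ring.
have not_all (d : quat 'F_l) : d != 0 -> exists p, qmul d (P p) != 0.
  move=> dn0; have [/existsP [p hp]|/existsPn h] := boolP [exists p, qmul d (P p) != 0].
    by exists p.
  have h' p : qmul d (P p) = 0 by apply/eqP/negPn; have := h p.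
  case/eqP: dn0; apply: (@quat_prime _ two d (P (1, 0))).
    by move=> s; rewrite -qmulA; have [p' ->] := left_ideal s (1, 0).
  by rewrite /P /isotropic_plane; apply/eqP => -[] /eqP; rewrite oner_eq0.
(* As [c conj c = 0], left multiplication by [conj c] sends the plane into the kernel of [c];
   [not_all] provides a nonzero image. *)
have [p0 [p0n0 hp0]] : exists p0, p0 != 0 /\ qmul c (P p0) = 0.
  have [|p hp] := not_all (qconj c).
    by apply: contraNneq cn0 => h; rewrite -(qconjK c) h qconj0.
  have [p' hp'] := left_ideal (qconj c) p; exists p'; split.
    apply: contraNneq hp => p'0; rewrite hp' p'0 /P /isotropic_plane /=.
    by rewrite !mulr0 subr0 addr0.
  by rewrite -hp' qmul_conj nc qscale0.
case: p0 => s0 t0 in p0n0 hp0.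
pose f (r : 'F_l) := (r * s0, r * t0).
have Pf r p : P (r * p.1, r * p.2) = qscale r (P p).
  by rewrite /P /isotropic_plane; congr (_, _, _, _) => /=; ring.
have f_inj : injective f.
  move=> r r' e; have /= h1 := congr1 fst e; have /= h2 := congr1 snd e.
  move: p0n0; have [s00|s0n] := eqVneq s0 0; last by rewrite (mulIf s0n h1).
  have [t00|t0n] := eqVneq t0 0; last by rewrite (mulIf t0n h2).
  by rewrite s00 t00 eqxx.
have f0 r : (f r == 0) = (r == 0).
  have <- : f 0 = 0 by rewrite /f !mul0r.
  exact: inj_eq.
suff -> : [set p : 'F_l * 'F_l | (p != 0) && (qmul c (P p) == 0)] = f @: [set~ 0].
  by rewrite card_imset // cardsC1 card_Fp.
apply/setP => p; rewrite inE; apply/andP/imsetP => [[pn0 /eqP hp]|[r]]; last first.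
  rewrite !inE -f0 => fr ->; split=> //.
  by rewrite /f (Pf r (s0, t0)) qmulZr hp0 qscaler0.
case: p => s t in pn0 hp *.
suff [r hr] : exists r, (s, t) = f r by exists r; rewrite // !inE -f0 -hr.
(* Cramer's rule: if [D] were nonzero, the two points would span the plane and [c] would kill all of
   it. *)
have D0 : s * t0 = t * s0.
  apply/eqP; rewrite -subr_eq0; apply: contraNT cn0 => Dn0; apply/eqP.
  set D := s * t0 - t * s0 in Dn0.
  apply: contraTeq isT => /not_all [[u v]].
  suff : qscale D (P (u, v)) = qscale (u * t0 - v * s0) (P (s, t)) + qscale (v * s - u * t) (P (s0, t0)).
    move=> h; have -> : qmul c (P (u, v)) = 0; last by rewrite eqxx.
    have : qscale D (qmul c (P (u, v))) = 0.
      rewrite -qmulZr h -[qscale (v * s - u * t) _]opprK qmulBr -qscaleN !qmulZr hp hp0.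
      by rewrite !qscaler0 subr0.
    by move/qscale_eq0; apply.
  by rewrite /D /P /isotropic_plane; congr (_, _, _, _) => /=; ring.
have [s00|s0n] := eqVneq s0 0.
  have t0n : t0 != 0 by move: p0n0; rewrite s00; apply: contraNneq => ->.
  exists (t / t0); rewrite /f divfK // s00 mulr0; congr (_, _).
  by move/eqP: D0; rewrite s00 mulr0 mulf_eq0 (negbTE t0n) orbF => /eqP.
by exists (s / s0); rewrite /f divfK // mulrAC D0 mulfK.
Qed.

End HeckeRelations.

(** * Hecke relations for four and three squares *)

Section RepresentationCounts.
Variable l : nat.
Hypotheses (l_prime : prime l) (l_odd : odd l).
Local Notation red := (qred l).
Local Notation A := (qnormset l).

Let l_neq0 : l%:Z != 0. Proof. by rewrite eqz_nat -lt0n prime_gt0. Qed.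

(** Count pairs of an [a] of norm [l] and a nonzero point of the plane killed by [conj a]: each [a]
    has [l - 1] points, each of the [l^2 - 1] points has 8 such [a]. *)
Lemma r4_prime : r4 l = (8 * l.+1)%N.
Proof.
have [a [b ab]] := Fp_sum_two_squares l_prime l_odd.
pose P := isotropic_plane a b.
pose s := enum [set p : 'F_l * 'F_l | p != 0].
have size_s : size s = (l.+1 * l.-1)%N.
  rewrite /s -cardE; have -> : [set p : 'F_l * 'F_l | p != 0] = [set~ (0, 0)].
    by apply/setP => p; rewrite !inE.
  rewrite cardsC1 card_prod !card_Fp //; have := prime_gt0 l_prime; nia.
have Pn0 p : p != 0 -> P p != 0.
  by apply: contraNneq => h; have /= h1 := congr1 (fun x => (x.1.1.1, x.1.1.2)) h;
     rewrite [p]surjective_pairing h1.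
have nP p : qnorm (P p) = 0.
  rewrite /P /isotropic_plane /=.
  have -> : p.1 ^+ 2 + p.2 ^+ 2 + (a * p.1 - b * p.2) ^+ 2 + (b * p.1 + a * p.2) ^+ 2
    = (a ^+ 2 + b ^+ 2 + 1) * (p.1 ^+ 2 + p.2 ^+ 2) by ring.
  by rewrite ab addNr mul0r.
have := @exchange_count _ _ A s (fun x p => left_annihilates x (P p)).
rewrite (@eq_big_seq _ _ _ _ A _ (fun=> l.-1)); last first.
  move=> x xA; rewrite -(@card_plane_kernel l l_prime l_odd a b (qconj (red x)) ab).
  - rewrite -size_filter cardE; apply: perm_size; apply: uniq_perm.
    + by rewrite filter_uniq ?enum_uniq.
    + exact: enum_uniq.
    + by move=> p; rewrite mem_filter !mem_enum !inE andbC.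
  - by rewrite qnorm_conj qnorm_qred_A.
  - apply/eqP => h; have /eqP := qred_A_neq0 l_prime xA; apply.
    by rewrite -(qconjK (red x)) h qconj0.
rewrite (@eq_big_seq _ _ _ _ s _ (fun=> 8%N)); last first.
  by move=> p; rewrite mem_enum inE => pn0; apply: count_left_factors => //; exact: Pn0.
rewrite !big_const_seq !count_predT !iter_addn_0 size_s -/(r4 l).
by have := prime_gt1 l_prime; nia.
Qed.

Lemma left_factor_div a x : a \in A -> left_annihilates a (red x) ->
  exists y, x = qmul a y.
Proof.
rewrite mem_qnormset => /eqP na /eqP; rewrite -qred_conj -qred_mul => /(qredP l_prime) [y hy].
by exists y; apply: (qscale_inj l_neq0); rewrite -na -qmul_conj hy qmulZr na.
Qed.

Lemma left_annihilates_mul a y : a \in A -> left_annihilates a (red (qmul a y)).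
Proof.
move=> aA; rewrite /left_annihilates qred_mul qconj_mul qnorm_qred_A //.
by rewrite qscale0.
Qed.

(** An [x] that is nonzero modulo [l] has 8 left factors; otherwise all 8([l] + 1) elements of [A]
    count, an excess of 8[l]. *)
Lemma sum_count_left (s : seq (quat int)) :
  (forall x, x \in s -> qnorm (red x) = 0) ->
  (\sum_(x <- s) count (fun a => left_annihilates a (red x)) A
    = 8 * size s + 8 * l * count (fun x => red x == 0%R) s)%N.
Proof.
elim: s => [|x s IH] h; first by rewrite big_nil !muln0.
rewrite big_cons IH => [|y ys]; last by apply: h; rewrite inE ys orbT.
have nx : qnorm (red x) = 0 by apply: h; rewrite inE eqxx.
have [x0|xn0] := eqVneq (red x) 0%R => /=; last by rewrite count_left_factors // (negbTE xn0); lia.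
rewrite (eq_count (a2 := predT)) ?count_predT => [|a]; last first.
  by rewrite /left_annihilates x0 qmulq0 eqxx.
by rewrite x0 eqxx -/(r4 l) r4_prime; lia.
Qed.

(** Count the factorizations [x = a y] with N([a]) = [l] and N([y]) = [n]. The witness [r] counts
    the [x] divisible by [l]; its term vanishes modulo [l]. *)
Lemma r4_hecke n : exists r, (r4 (l * n) + l * r = l.+1 * r4 n)%N.
Proof.
exists (count (fun x => red x == 0%R) (qnormset (l * n))).
have nred x : x \in qnormset (l * n) -> qnorm (red x) = 0.
  rewrite mem_qnormset => /eqP nx; apply/eqP.
  by rewrite qmap_norm nx PoszM intr_Fp_eq0 // dvdz_mulr.
have := sum_count_left nred; rewrite -/(r4 _).
rewrite (exchange_count _ _ (fun x a => left_annihilates a (red x))).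
rewrite (@eq_big_seq _ _ _ _ A _ (fun=> r4 n)) => [|a aA].
  by rewrite big_const_seq count_predT iter_addn_0 -/(r4 l) r4_prime; nia.
have na : qnorm a = l by apply/eqP; rewrite -mem_qnormset.
rewrite /r4 -(count_predT (qnormset n)); symmetry.
apply: (@eq_count_bij _ _ _ _ _ _ (qmul a) (fun x => qdiv l (qmul (qconj a) x)));
  rewrite ?qnormset_uniq //.
  move=> y; rewrite !mem_qnormset => /eqP ny _; split.
  - by rewrite qnormM na ny -PoszM.
  - exact: left_annihilates_mul.
  - by rewrite qconj_mul na qdivK.
move=> x; rewrite !mem_qnormset => /eqP nx hx.
have [y hy] := left_factor_div aA hx.
have -> : qdiv l (qmul (qconj a) x) = y by rewrite hy qconj_mul na qdivK.
split=> //; apply/eqP; apply: (mulfI l_neq0).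
by rewrite -{1}na -qnormM -hy nx PoszM.
Qed.

Definition qrotate a v : quat int := qmul (qmul a v) (qconj a).

(** Inverts [qrotate a] on its image: [conj a a = l] on both sides leaves a factor [l^2]. *)
Definition qunrotate a w : quat int := qdiv (l%:Z ^+ 2) (qmul (qmul (qconj a) w) a).

Lemma qconj_rotate a v : a \in A -> qmul (qmul (qconj a) (qrotate a v)) a = qscale (l%:Z ^+ 2) v.
Proof.
rewrite mem_qnormset => /eqP na.
rewrite /qrotate -!qmulA qmulconjq qmul_realr !qmulZr qconj_mul.
by rewrite qscaleA na expr2.
Qed.

Lemma qrotateK a v : a \in A -> qunrotate a (qrotate a v) = v.
Proof. by move=> aA; rewrite /qunrotate qconj_rotate // qdivK // expf_neq0. Qed.

Lemma qnorm_rotate a v : a \in A -> qnorm (qrotate a v) = l%:Z ^+ 2 * qnorm v.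
Proof.
by rewrite mem_qnormset => /eqP na; rewrite !qnormM qnorm_conj na; ring.
Qed.

(* [w = a v conj a] for an integral [v], tested on the only candidate for [v]. *)
Definition is_rotation a w := qrotate a (qunrotate a w) == w.

Lemma is_rotationP a w : a \in A -> is_rotation a w <-> exists v, w = qrotate a v.
Proof.
move=> aA; split; first by move/eqP=> <-; eexists.
by case=> v ->; rewrite /is_rotation qrotateK.
Qed.

Section PureQuaternions.
Variable n : nat.
Hypothesis nonresidue : forall r : 'F_l, r ^+ 2 <> - (n%:Z)%:~R.

(** Write [w = l w']. If [w = a v conj a], then [conj a w' a = l v] vanishes modulo [l], and
    [sandwich_square] makes [-n] a square. *)
Lemma not_rotation_multiple a w : a \in A -> qre w = 0 -> qnorm w = l%:Z ^+ 2 * n%:Z ->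
  red w = 0 -> ~ is_rotation a w.
Proof.
move=> aA rw nw /(qredP l_prime) [w' hw] /(is_rotationP _ aA) [v hv].
have l2 : l%:Z ^+ 2 != 0 by rewrite expf_neq0.
have nw' : qnorm w' = n%:Z by apply: (mulfI l2); rewrite -nw hw qnormZ.
have rw' : qre w' = 0.
  by move: rw; rewrite hw; case: (w') => [[[? ?] ?] ?]; rewrite /qre /= => /eqP;
     rewrite mulf_eq0 (negbTE l_neq0) => /eqP.
have h : qmul (qmul (qconj a) w') a = qscale l%:Z v.
  apply: (qscale_inj l_neq0); rewrite qscaleA -expr2 -(qconj_rotate v aA) -hv hw.
  by rewrite qmulZr qmulZl.
have h0 : qmul (qmul (qconj (red a)) (red w')) (red a) = 0.
  by rewrite -qred_conj -!qred_mul h; apply/(qredP l_prime); exists v.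
have [r hr] := @sandwich_square _ (Fp_two_neq0 l_prime l_odd) (red a) (red w') _
  (etrans (qmap_re _ _) (congr1 intr rw')) (etrans (qmap_norm _ _) (congr1 intr nw'))
  (qred_A_neq0 l_prime aA) (qnorm_qred_A l_prime aA) h0.
exact: (nonresidue hr).
Qed.

(** If [w = a b], then N([b]) = [l n], so [a] and [b] are null modulo [l] with pure product;
    [swap_null_factors] gives [b a = l u], whence [a u conj a = w]. *)
Lemma is_rotationE a w : a \in A -> qre w = 0 -> qnorm w = l%:Z ^+ 2 * n%:Z ->
  red w != 0 -> is_rotation a w = left_annihilates a (red w).
Proof.
move=> aA rw nw wn0; have na : qnorm a = l by apply/eqP; rewrite -mem_qnormset.
apply/idP/idP => [/(is_rotationP _ aA) [v ->]|].
  by rewrite /qrotate -qmulA left_annihilates_mul.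
move=> /(left_factor_div aA) [b hb]; apply/(is_rotationP _ aA).
have nb : qnorm (red b) = 0.
  apply/eqP; rewrite qmap_norm intr_Fp_eq0 //.
  have -> : qnorm b = l%:Z * n%:Z; last by rewrite dvdz_mulr.
  by apply: (mulfI l_neq0); rewrite mulrA -expr2 -nw hb qnormM na.
have := swap_null_factors (Fp_two_neq0 l_prime l_odd) (qnorm_qred_A l_prime aA) nb.
rewrite -!qred_mul -hb qmap_re rw => /(_ (erefl _) wn0) /(qredP l_prime) [u hu].
exists u; apply: (qscale_inj (expf_neq0 2 l_neq0)).
rewrite expr2 -!qscaleA; congr (qscale _ _).
by rewrite /qrotate -qmulZl -qmulZr -hu qmulA -hb qmul_conjr na.
Qed.

(** Count pairs with [w = a v conj a]: each [a] has r3(n) of them, each [w] has 8 if [l] does not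
    divide it and none otherwise. As r3(n) of the [w] are multiples of [l], 8(l + 1) r3(n) =
    8(r3(l^2 n) - r3(n)). *)
Lemma r3_hecke : r3 (l ^ 2 * n) = (l.+2 * r3 n)%N.
Proof.
pose W := [seq w <- qnormset (l ^ 2 * n) | qre w == 0].
have WP w : w \in W -> qre w = 0 /\ qnorm w = l%:Z ^+ 2 * n%:Z.
  by rewrite mem_filter mem_qnormset => /andP [/eqP -> /eqP ->]; rewrite PoszM -rmorphXn.
have W_uniq : uniq W by rewrite filter_uniq ?qnormset_uniq.
have lhs : (\sum_(a <- A) count (is_rotation a) W = r4 l * r3 n)%N.
  rewrite (@eq_big_seq _ _ _ _ A _ (fun=> r3 n)) => [|a aA].
    by rewrite big_const_seq count_predT iter_addn_0 mulnC.
  have na : qnorm a = l by apply/eqP; rewrite -mem_qnormset.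
  symmetry; apply: (@eq_count_bij _ _ _ _ _ _ (qrotate a) (qunrotate a)) => //.
  - exact: qnormset_uniq.
  - move=> v; rewrite mem_qnormset => /eqP nv /eqP rv.
    split; rewrite ?qrotateK //; last by rewrite /is_rotation qrotateK.
    rewrite mem_filter mem_qnormset qre_sandwich rv mulr0 eqxx /=.
    by rewrite qnorm_rotate // nv PoszM -rmorphXn.
  move=> w /WP [rw nw] /eqP hw; split=> //.
    rewrite mem_qnormset; apply/eqP; apply: (mulfI (expf_neq0 2 l_neq0)).
    by rewrite -(qnorm_rotate (qunrotate a w) aA) hw.
  apply/eqP; apply: (mulfI l_neq0); rewrite mulr0 -rw -{2}hw qre_sandwich na.
  by [].
have rhs : (\sum_(w <- W) count (is_rotation^~ w) A = 8 * count (fun w => red w != 0%R) W)%N.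
  rewrite -sum1_count big_distrr /= [RHS]big_mkcond /=; apply: eq_big_seq => w /WP [rw nw].
  have [w0|wn0] /= := eqVneq (red w) 0.
    rewrite (@eq_in_count _ _ pred0) ?count_pred0 // => a aA.
    by apply/negP; apply: not_rotation_multiple.
  rewrite muln1 -(@count_left_factors l l_prime l_odd (red w)) //.
    by apply: eq_in_count => a aA; rewrite is_rotationE.
  apply/eqP; rewrite qmap_norm nw intr_Fp_eq0 //.
  by rewrite expr2 -mulrA dvdz_mulr.
have mults : count (fun w => red w == 0%R) W = r3 n.
  symmetry; apply: (@eq_count_bij _ _ _ _ _ _ (qscale l%:Z) (qdiv l%:Z)) => //.
  - exact: qnormset_uniq.
  - move=> v; rewrite mem_qnormset => /eqP nv /eqP rv; split; last by rewrite qdivK.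
      rewrite mem_filter mem_qnormset qnormZ nv PoszM -rmorphXn eqxx andbT.
      by move: rv; case: (v) => [[[? ?] ?] ?]; rewrite /qre /= => ->; rewrite mulr0.
    by apply/eqP/(qredP l_prime); exists v.
  move=> w /WP [rw nw] /eqP /(qredP l_prime) [v hv]; rewrite hv qdivK //; split=> //.
    rewrite mem_qnormset; apply/eqP; apply: (mulfI (expf_neq0 2 l_neq0)).
    by rewrite -nw hv qnormZ.
  by move: rw; rewrite hv; case: (v) => [[[? ?] ?] ?]; rewrite /qre /= => /eqP;
     rewrite mulf_eq0 (negbTE l_neq0).
have := exchange_count A W is_rotation; rewrite lhs rhs r4_prime => h.
have -> : r3 (l ^ 2 * n) = size W by rewrite size_filter.
rewrite -(count_predC (fun w => red w == 0%R)) mults.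
have -> : count (predC (fun w => red w == 0%R)) W = count (fun w => red w != 0%R) W by [].
by nia.
Qed.
End PureQuaternions.

End RepresentationCounts.

(** Squares are 0 or 1 modulo 4, so three squares with sum divisible by 4 are all even. *)
Lemma r3_mul4 n : r3 (4 * n) = r3 n.
Proof.
have two0 : 2%:Z != 0 by [].
have four m : (4 * m)%N%:Z = 2%:Z ^+ 2 * m%:Z by rewrite PoszM.
symmetry; apply: (@eq_count_bij _ _ _ _ _ _ (qscale 2%:Z) (qdiv 2%:Z)).
- exact: qnormset_uniq.
- exact: qnormset_uniq.
- move=> v; rewrite !mem_qnormset => /eqP nv /eqP rv; split; last by rewrite qdivK.
    by rewrite qnormZ nv four.
  by move: rv; case: (v) => [[[? ?] ?] ?]; rewrite /qre /= => ->.
move=> w; rewrite !mem_qnormset => /eqP nw /eqP rw.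
suff [v hv] : exists v, w = qscale 2%:Z v.
  rewrite hv qdivK //; split=> //.
    by apply/eqP; apply: (mulfI (expf_neq0 2 two0)); rewrite -four -nw hv qnormZ.
  by move: rw; rewrite hv; case: (v) => [[[? ?] ?] ?]; rewrite /qre /=; lia.
case: w rw nw => [[[x0 x1] x2] x3]; rewrite /qre /= => -> nw.
have parity (z : int) : exists y r : int,
    [/\ z = 2 * y + r, r = 0 \/ r = 1 & z ^+ 2 = 4 * (y * y + y * r) + r].
  exists (z %/ 2)%Z, (z %% 2)%Z.
  have hr : (z %% 2)%Z = 0 \/ (z %% 2)%Z = 1 by lia.
  have hz := divz_eq z 2; split=> //; first by lia.
  by rewrite {1}hz; case: hr => ->; ring.
have [y1 [s1 [e1 h1 q1]]] := parity x1; have [y2 [s2 [e2 h2 q2]]] := parity x2.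
have [y3 [s3 [e3 h3 q3]]] := parity x3.
have [z1 z2 z3] : [/\ s1 = 0, s2 = 0 & s3 = 0].
  move: nw; rewrite q1 q2 q3 expr0n /=.
  move: (_ + _ * s1) (_ + _ * s2) (_ + _ * s3) => u1 u2 u3 nw; split; lia.
by exists (0, y1, y2, y3); rewrite /= e1 e2 e3 z1 z2 z3; congr (_, _, _, _); lia.
Qed.

Local Close Scope ring_scope.

(** * Recurrence for overpartitions with bounded parts *)

Lemma parts_le_fuel f f' m n : n <= f -> n <= f' -> parts_le f m n = parts_le f' m n.
Proof.
elim: f f' m n => [|f IH] [|f'] m [|n] //= nf nf'.
by congr flatten; apply: eq_map => j; rewrite (IH f') //; lia.
Qed.

(** The bound [m] is the parameter along which the product formula is built, one factor at a
    time. *)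
Definition overcount (m n : nat) := \sum_(s <- parts_le n m n) 2 ^ size (undup s).

Lemma overcount_overpartition m n : n <= m -> overcount m n = overpartition_count n.
Proof.
rewrite /overcount /overpartition_count /partitions; case: n => [//|n] nm /=.
by rewrite (minn_idPr nm) minnn.
Qed.

Lemma overcount0 m : overcount m 0 = 1.
Proof. by rewrite /overcount /= big_seq1. Qed.

(** Contribution of the partitions with largest part [j + 1], one copy of which is split off. *)
Definition overcount_head (j n : nat) :=
  \sum_(s <- parts_le (n - j.+1) j.+1 (n - j.+1)) 2 ^ size (undup (j.+1 :: s)).

Lemma parts_le_bound f m n s : s \in parts_le f m n -> all (leq^~ m) s.
Proof.
elim: f m n s => [|f IH] m n s /=; case: eqP => _ //; rewrite ?inE; try by move/eqP->.
case/flatten_mapP => j; rewrite mem_iota => hj /mapP [s' /IH hs' ->] /=.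
apply/andP; split; first by lia.
by apply: sub_all hs' => x /= hx; lia.
Qed.

Lemma sum_parts_le (P : pred (seq nat)) (F : seq nat -> nat) m n : 0 < n ->
  \sum_(s <- parts_le n m n | P s) F s =
  \sum_(0 <= j < minn m n) \sum_(s <- parts_le (n - j.+1) j.+1 (n - j.+1) | P (j.+1 :: s)) F (j.+1 :: s).
Proof.
case: n => // n _ /=; rewrite big_mkcond big_flatten big_map /= /index_iota subn0.
rewrite !big_seq; apply: eq_bigr => j; rewrite mem_iota => hj.
rewrite big_map [RHS]big_mkcond (@parts_le_fuel n (n.+1 - j.+1)) //; lia.
Qed.

Lemma overcountS_head m n :
  overcount m.+1 n = overcount m n + (if m < n then overcount_head m n else 0).
Proof.
case: (posnP n) => [->|n0]; first by rewrite !overcount0.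
rewrite /overcount !(sum_parts_le predT) //.
case: ltnP => mn; last by rewrite (minn_idPr (leqW mn)) addn0.
by rewrite (minn_idPl mn) big_nat_recr.
Qed.

Lemma overcount_avoid m k :
  \sum_(s <- parts_le k m.+1 k | m.+1 \notin s) 2 ^ size (undup s) = overcount m k.
Proof.
case: (posnP k) => [->|k0]; first by rewrite /overcount /= !big_cons !big_nil.
rewrite /overcount sum_parts_le // [RHS](sum_parts_le predT) //.
have below j : j < m -> \sum_(s <- parts_le (k - j.+1) j.+1 (k - j.+1) | m.+1 \notin j.+1 :: s)
      2 ^ size (undup (j.+1 :: s))
    = \sum_(s <- parts_le (k - j.+1) j.+1 (k - j.+1)) 2 ^ size (undup (j.+1 :: s)).
  move=> jm; rewrite big_seq_cond [RHS]big_seq_cond; apply: eq_bigl => s; rewrite andbT.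
  apply: andb_idr => /parts_le_bound/allP sP.
  rewrite inE negb_or neq_ltn (ltnS j.+1) jm orbT /=.
  by apply/negP => /sP; rewrite ltnNge jm.
case: (ltnP m k) => mk.
  rewrite (minn_idPl mk) big_nat_recr //= [X in _ + X]big_pred0.
    by rewrite addn0; apply: eq_big_nat => j hj; apply: below; lia.
  by move=> s; rewrite inE eqxx.
rewrite (minn_idPr (leqW mk)).
by apply: eq_big_nat => j hj; apply: below; lia.
Qed.

(* A partition with largest part [m + 1]: removing one copy loses the factor 2
   exactly when [m + 1] does not occur again. *)
Lemma overcount_rec m n : m < n ->
  overcount m.+1 n = overcount m n + overcount m.+1 (n - m.+1) + overcount m (n - m.+1).
Proof.
move=> mn; rewrite overcountS_head mn -addnA; congr (_ + _).
rewrite -(overcount_avoid m) /overcount [X in _ + X]big_mkcond -big_split /=.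
apply: eq_bigr => s _ /=; case: (m.+1 \in s) => /=; first by rewrite addn0.
by rewrite expnS; lia.
Qed.

Lemma overcount_small m n : n <= m -> overcount m.+1 n = overcount m n.
Proof. by move=> nm; rewrite overcountS_head ltnNge nm addn0. Qed.

Lemma overcount0n n : 0 < n -> overcount 0 n = 0.
Proof.
by move=> n0; rewrite /overcount (sum_parts_le predT) // min0n big_geq.
Qed.

Local Open Scope ring_scope.

(** * A finite form of Gauss' identity *)

Section FiniteGauss.
Variables (R : comNzRingType) (q : R).

Definition theta_sum n : R := 1 + (\sum_(1 <= s < n.+1) (-1) ^+ s * q ^+ (s ^ 2)) *+ 2.

(** Half the error term of the finite identity; every summand carries a factor [q^(n+1)], so it
    disappears in the limit. *)
Definition gauss_tail n : R := \sum_(1 <= s < n.+1)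
  (-1) ^+ s * q ^+ (s * n.+1) * \prod_(s.+1 <= k < n.+1) (1 - q ^+ k)
  * \prod_(1 <= k < s) (1 + q ^+ k).

Lemma gauss_tailS n : gauss_tail n.+1 =
  q ^+ n.+1 * \prod_(1 <= k < n.+1) (1 - q ^+ k) + (1 + q ^+ n.+1) * gauss_tail n
  + (-1) ^+ n.+1 * q ^+ (n.+1 ^ 2) * \prod_(1 <= k < n.+2) (1 + q ^+ k).
Proof.
pose x := q ^+ n.+1.
(* The summands of [gauss_tail n.+1 - (1 + x) gauss_tail n] telescope with this primitive. *)
pose U s := (-1) ^+ s * x ^+ s * \prod_(s <= k < n.+1) (1 - q ^+ k)
  * \prod_(1 <= k < s) (1 + q ^+ k).
have step s : (1 <= s < n.+1)%N ->
    (-1) ^+ s * q ^+ (s * n.+2) * \prod_(s.+1 <= k < n.+2) (1 - q ^+ k)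
      * \prod_(1 <= k < s) (1 + q ^+ k)
    = (1 + x) * ((-1) ^+ s * q ^+ (s * n.+1) * \prod_(s.+1 <= k < n.+1) (1 - q ^+ k)
      * \prod_(1 <= k < s) (1 + q ^+ k)) + (U s.+1 - U s).
  move=> /andP [s0 sn]; rewrite /U [\prod_(1 <= k < s.+1) _]big_nat_recr //=.
  rewrite [\prod_(s <= k < n.+1) _]big_ltn // [\prod_(s.+1 <= k < n.+2) _]big_nat_recr //=.
  rewrite mulnS exprD (mulnC s n.+1) exprM -/x !exprS.
  by ring.
rewrite {1}/gauss_tail big_nat_recr //=.
rewrite (eq_big_nat _ _ step) big_split /= -big_distrr /= -/(gauss_tail n).
rewrite telescope_sumr // /U [\prod_(n.+2 <= k < n.+2) _]big_geq //
  [\prod_(n.+1 <= k < n.+1) _]big_geq // [\prod_(1 <= k < 1) _]big_geq //.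
rewrite [\prod_(1 <= k < n.+2) _]big_nat_recr //= mulnS exprD -[(n.+1 ^ 2)%N]mulnn exprM -/x.
by rewrite !expr1; ring.
Qed.

Lemma finite_gauss n :
  \prod_(1 <= k < n.+1) (1 + q ^+ k) * theta_sum n
  = \prod_(1 <= k < n.+1) (1 - q ^+ k) + gauss_tail n *+ 2.
Proof.
elim: n => [|n IH]; first by rewrite /theta_sum /gauss_tail !big_geq // mul0rn addr0 mulr1.
rewrite gauss_tailS /theta_sum [\sum_(1 <= s < n.+2) _]big_nat_recr //=.
rewrite mulrnDl addrA mulrDr -/(theta_sum n).
rewrite {1}big_nat_recr //= mulrAC IH [\prod_(1 <= k < n.+2) (1 - _)]big_nat_recr //=.
by ring.
Qed.

End FiniteGauss.

(** * Generating functions modulo a power of X *)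

Section TruncatedSeries.
Variable F : fieldType.
Implicit Types p u : {poly F}.

Lemma dvd_XnP N p : reflect (forall i, (i < N)%N -> p`_i = 0) ('X^N %| p).
Proof.
apply: (iffP idP) => [/dvdpP [r ->] i iN|h]; first by rewrite coefMXn iN.
rewrite -(poly_take_drop N p) dvdp_addl ?dvdp_mull //.
rewrite (_ : take_poly N p = 0) ?dvdp0 //; apply/polyP => i.
by rewrite coef_take_poly coef0; case: ifP => // /h.
Qed.

(** A nonzero constant term makes [u] coprime to X, that is, invertible as a power series. *)
Lemma dvd_Xn_cancel N u p : u`_0 != 0 -> 'X^N %| u * p -> 'X^N %| p.
Proof.
move=> u0; rewrite Gauss_dvdpr // coprimep_expl //.
by have := coprimep_XsubC u 0; rewrite subr0 coprimep_sym => ->; rewrite /root horner_coef0.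
Qed.

Definition overpoly N m : {poly F} := \poly_(i < N) (overcount m i)%:R.

(** [overcount_rec] for generating functions: allowing the part [m + 1] multiplies by (1 + X^(m+1))
    / (1 - X^(m+1)). *)
Lemma overpoly_rec N m :
  'X^N %| (1 - 'X^(m.+1)) * overpoly N m.+1 - (1 + 'X^(m.+1)) * overpoly N m.
Proof.
apply/dvd_XnP => i iN; rewrite mulrBl mulrDl !mul1r !(coefB, coefD) !coefXnM !coef_poly iN.
case: ltnP => mi; first by rewrite overcount_small // subr0 addr0 subrr.
have -> : (i - m.+1 < N)%N by lia.
by rewrite overcount_rec // !natrD; ring.
Qed.

Lemma overpoly_prod N m : 'X^N %|
  \prod_(1 <= k < m.+1) (1 - 'X^k) * overpoly N m - \prod_(1 <= k < m.+1) (1 + 'X^k).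
Proof.
elim: m => [|m IH].
  rewrite !big_geq // mul1r; apply/dvd_XnP => i iN.
  rewrite coefB coef_poly iN coef1; case: i iN => [|i] _; first by rewrite overcount0 subrr.
  by rewrite overcount0n // subr0.
rewrite [\prod_(1 <= k < m.+2) (1 - _)]big_nat_recr // [\prod_(1 <= k < m.+2) (1 + _)]big_nat_recr //=.
set M := \prod_(1 <= k < m.+1) (1 - _) in IH *; set E := \prod_(1 <= k < m.+1) (1 + _) in IH *.
have -> : M * (1 - 'X^(m.+1)) * overpoly N m.+1 - E * (1 + 'X^(m.+1))
  = M * ((1 - 'X^(m.+1)) * overpoly N m.+1 - (1 + 'X^(m.+1)) * overpoly N m)
    + (1 + 'X^(m.+1)) * (M * overpoly N m - E) by ring.
by rewrite dvdp_add // dvdp_mull // overpoly_rec.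
Qed.

(** With [G] the overpartition polynomial, [M G = E] and [E theta = M] modulo X^N; cancel [M]. *)
Lemma overpoly_theta N : 'X^N %| overpoly N N * theta_sum 'X N - 1.
Proof.
pose M : {poly F} := \prod_(1 <= k < N.+1) (1 - 'X^k).
apply: (@dvd_Xn_cancel _ M).
  rewrite -horner_coef0 /M horner_prod big_seq big1 ?oner_neq0 // => k.
  rewrite mem_index_iota => /andP [k0 _].
  by rewrite !hornerE expr0n (gtn_eqF k0) subr0.
pose E : {poly F} := \prod_(1 <= k < N.+1) (1 + 'X^k).
have -> : M * (overpoly N N * theta_sum 'X N - 1)
  = (M * overpoly N N - E) * theta_sum 'X N + (E * theta_sum 'X N - M) by ring.
rewrite dvdp_add ?dvdp_mulr ?overpoly_prod // finite_gauss addrAC subrr add0r.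
rewrite -mulr_natr dvdp_mulr // /gauss_tail big_seq.
apply: (big_ind (fun p => 'X^N %| p)) => [|p1 p2|s]; rewrite ?dvdp0 //; first exact: dvdp_add.
rewrite mem_index_iota => /andP [s0 _].
rewrite -!mulrA dvdp_mull // dvdp_mulr // dvdp_exp2l //.
by rewrite (leq_trans (leqnSn N)) // leq_pmull.
Qed.
End TruncatedSeries.

(** * Powers of theta and sums of squares *)

Section ThetaPowers.
Variable R : comNzRingType.

Definition theta (y : R) n : R := \sum_(j <- int_ball n) y ^+ (`|j| ^ 2)%N.

(** Since [s] and [s^2] have the same parity, the sign is absorbed into the argument: (-1)^s q^(s^2)
    = (-q)^(s^2). *)
Lemma theta_sumE (q : R) n : theta_sum q n = theta (- q) n.
Proof.
pose f (k : nat) := (- q) ^+ (k ^ 2).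
have -> : theta (- q) n = f 0%N + (\sum_(1 <= s < n.+1) f s) *+ 2.
  rewrite /theta /int_ball big_map.
  elim: n => [|n IH]; first by rewrite big_geq // mul0rn addr0 big_seq1.
  (* Splits off both ends of the range, the terms of index -(n + 1) and n + 1. *)
  have iotaE k : iota 0 k.+2 = 0%N :: rcons [seq i.+1 | i <- iota 0 k] k.+1.
    rewrite -cats1 -[iota 0 k.+2]/(0%N :: iota 1 k.+1) -{1}(addn1 k) iotaD.
    by rewrite -{1}(addn0 1%N) iotaDl.
  rewrite doubleS iotaE.
  rewrite big_cons big_rcons big_map /= big_nat_recr //= mulrnDl.
  rewrite (eq_bigr (fun i : nat => (- q) ^+ (`|i%:Z - n%:Z| ^ 2)%N)) ?IH; last first.
    by move=> i _; congr (_ ^+ (_ ^ 2)); lia.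
  have -> : (- q) ^+ (`|0%:Z - n.+1%:Z| ^ 2)%N = f n.+1 by congr (_ ^+ (_ ^ 2)); lia.
  have -> : (- q) ^+ (`|n.*2.+2%:Z - n.+1%:Z| ^ 2)%N = f n.+1 by congr (_ ^+ (_ ^ 2)); lia.
  by ring.
rewrite /theta_sum /f expr0; congr (_ + _ *+ 2); apply: eq_bigr => s _.
by rewrite [RHS]exprNn -[in RHS]signr_odd oddX /= signr_odd.
Qed.

(** The norm is a sum of four squares, so the sum factors over coordinates. [P] will leave the real
    part free for r4 and pin it to 0 for r3. *)
Lemma theta_quat_box (y : R) (P : pred int) K :
  \sum_(x <- quat_box K | P (qre x)) y ^+ `|qnorm x|%N
  = (\sum_(j <- int_ball K | P j) y ^+ (`|j| ^ 2)%N) * theta y K ^+ 3.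
Proof.
have sum_pairs (I J : Type) (s : seq I) (t : seq J) (Q : pred I) (f : I -> R) (g : J -> R) :
    \sum_(p <- [seq (a, b) | a <- s, b <- t] | Q p.1) f p.1 * g p.2
    = (\sum_(a <- s | Q a) f a) * (\sum_(b <- t) g b).
  rewrite big_mkcond big_allpairs big_distrl [RHS]big_mkcond /=; apply: eq_bigr => a _.
  by case: (Q a); [rewrite big_distrr | rewrite big1].
pose g (j : int) := y ^+ (`|j| ^ 2)%N.
rewrite (eq_bigr (fun x => g x.1.1.1 * g x.1.1.2 * g x.1.2 * g x.2)); last first.
  case=> [[[a b] c] d] _ /=; rewrite /g -!exprD; congr (y ^+ _).
  have e (z : int) : (`|z| ^ 2)%N%:Z = z ^+ 2 by rewrite -abszX gez0_abs ?sqr_ge0.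
  by rewrite -!e -!PoszD.
rewrite (sum_pairs _ _ _ _ (fun x => P x.1.1) (fun x => g x.1.1 * g x.1.2 * g x.2) g).
rewrite (sum_pairs _ _ _ _ (fun x => P x.1) (fun x => g x.1 * g x.2) g).
by rewrite sum_pairs exprS expr2 !mulrA.
Qed.

End ThetaPowers.

Section ThetaCoefficients.
Variable R : comNzRingType.
Local Notation th := (theta (- 'X : {poly R})).

(** For [i <= K] the box contains every quaternion of norm [i], so truncating theta does not change
    this coefficient. *)
Lemma coef_quat_box (P : pred int) K i : (i <= K)%N ->
  (\sum_(x <- quat_box K | P (qre x)) (- 'X : {poly R}) ^+ `|qnorm x|%N)`_i
  = (-1) ^+ i * (count (fun x => P (qre x)) (qnormset i))%:R.
Proof.
move=> iK.
have -> : count (fun x => P (qre x)) (qnormset i)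
    = count (fun x => P (qre x) && (qnorm x == i%:Z)) (quat_box K).
  apply: (@eq_count_bij _ _ _ _ _ _ id id); rewrite ?qnormset_uniq ?quat_box_uniq //.
    by move=> x; rewrite mem_qnormset => /eqP nx Px; rewrite nx eqxx Px (mem_quat_box_norm iK nx).
  by move=> x _ /andP [Px nx]; rewrite mem_qnormset.
have coefN e : ((- 'X : {poly R}) ^+ e)`_i = if e == i then (-1) ^+ i else 0.
  have -> : (- 'X) ^+ e = ((-1) ^+ e) *: 'X^e :> {poly R}.
    by rewrite -mul_polyC polyC_exp polyCN polyC1 [LHS]exprNn.
  by rewrite coefZ coefXn eq_sym; case: eqP => [->|_]; rewrite (mulr1, mulr0).
rewrite -sum1_count natr_sum big_distrr /= coef_sum [RHS]big_mkcondr /=.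
apply: eq_bigr => x _; rewrite coefN mulr1.
by have := qnorm_ge0 x; case: (qnorm x).
Qed.

Lemma coef_theta4 K i : (i <= K)%N -> (th K ^+ 4)`_i = (-1) ^+ i * (r4 i)%:R.
Proof.
move=> iK; have := @coef_quat_box predT K i iK.
by rewrite theta_quat_box -exprS count_predT.
Qed.

Lemma coef_theta3 K i : (i <= K)%N -> (th K ^+ 3)`_i = (-1) ^+ i * (r3 i)%:R.
Proof.
move=> iK; have := @coef_quat_box (pred1 0) K i iK.
rewrite theta_quat_box big_mkcond (bigD1_seq (0 : int)) ?mem_int_ball ?int_ball_uniq //=.
by rewrite expr0 big1 ?addr0 ?mul1r // => j /negbTE ->.
Qed.
End ThetaCoefficients.

(** * Extraction of exponents divisible by 5, and reduction modulo 5 *)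

Section Dissection.
Variable R : comNzRingType.
Implicit Types p q : {poly R}.

Definition dissect m p : {poly R} := \poly_(i < size p) p`_(m * i).

Lemma coef_dissect m p i : (0 < m)%N -> (dissect m p)`_i = p`_(m * i).
Proof.
move=> m0; rewrite coef_poly; case: ltnP => // pi.
by rewrite nth_default // (leq_trans pi) // leq_pmull.
Qed.

(** Extraction is linear over polynomials in X^m, with X^m turning into X. *)
Lemma dissect_mul m p q : (0 < m)%N -> dissect m (p * (q \Po 'X^m)) = dissect m p * q.
Proof.
move=> m0; elim/poly_ind: q p => [|q c IH] p.
  rewrite comp_poly0 !mulr0; apply/polyP => i.
  by rewrite coef_dissect // !coef0.
have -> : p * ((q * 'X + c%:P) \Po 'X^m) = p * (q \Po 'X^m) * 'X^m + p * c%:P.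
  by rewrite comp_poly_MXaddC mulrDr mulrA.
apply/polyP => i; rewrite mulrDr mulrA -IH coef_dissect // !coefD !coefMC coef_dissect //.
congr (_ + _); rewrite coefMXn coefMX; case: i => [|i] /=; first by rewrite muln0 m0.
by rewrite coef_dissect // ltnNge mulnS leq_addr addKn.
Qed.
End Dissection.

Lemma pchar_polyF5 : 5 \in [pchar {poly 'F_5}].
Proof. by rewrite (rmorph_pchar (@polyC 'F_5)) // pchar_Fp. Qed.

(** Frobenius is additive in characteristic 5, and (-X)^5 = -X^5 is the substitution of X^5 in
    -X. *)
Lemma theta_pow5 K : theta (- 'X : {poly 'F_5}) K ^+ 5 = theta (- 'X) K \Po 'X^5.
Proof.
rewrite -(pFrobenius_autE pchar_polyF5) /theta !rmorph_sum /=.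
apply: eq_bigr => j _; rewrite pFrobenius_autE -exprM mulnC exprM !rmorphXn /=.
by congr (_ ^+ _); rewrite rmorphN /= comp_polyX exprNn -signr_odd expr1 mulN1r.
Qed.

(** Up to truncation [G T = 1], so G T(X^5) = T^4. Extraction turns this into
    [T * dissect 5 G = T^4], because r4(5i) = r4(i) modulo 5; cancelling [T] leaves T^3. *)
Lemma overpartition_5n_mod5 n :
  (overpartition_count (5 * n))%:R = (-1) ^+ n * (r3 n)%:R :> 'F_5.
Proof.
(* Precision [5 M] before extraction leaves [M = n + 1] after it, just enough for the coefficient of
   X^n. *)
pose M := n.+1; pose N := (5 * M)%N.
pose G := overpoly 'F_5 N N; pose T := theta (- 'X : {poly 'F_5}) N.
have GT : 'X^N %| G * T - 1 by rewrite /T -theta_sumE overpoly_theta.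
have GT5 : 'X^N %| G * (T \Po 'X^5) - T ^+ 4.
  rewrite -theta_pow5 exprS -/T.
  have -> : G * (T * T ^+ 4) - T ^+ 4 = (G * T - 1) * T ^+ 4 by ring.
  exact: dvdp_mulr.
have DG : 'X^M %| T * (dissect 5 G - T ^+ 3).
  apply/dvd_XnP => i iM; rewrite mulrBr -exprS coefB mulrC -dissect_mul // coef_dissect //.
  have /dvd_XnP /(_ (5 * i)%N) := GT5; rewrite ltn_pmul2l // => /(_ iM) /eqP.
  rewrite coefB subr_eq0 => /eqP ->.
  rewrite !coef_theta4; try by rewrite /N; lia.
  have [r hr] := @r4_hecke 5 isT isT i.
  rewrite exprM -[(-1) ^+ 5]signr_odd expr1 -mulrBr.
  suff -> : (r4 (5 * i))%:R = (r4 i)%:R :> 'F_5 by rewrite subrr mulr0.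
  have := congr1 (fun m => m%:R : 'F_5) hr.
  by rewrite natrD !natrM pchar_Fp_0 // mul0r addr0 -[6%N]addn1 natrD pchar_Fp_0 // add0r mul1r.
have T0 : T`_0 != 0.
  have /dvd_XnP /(_ 0%N isT) := GT; rewrite coefB coef0M coef1 => /eqP.
  by rewrite subr_eq0 => /eqP h; apply: contra_eq_neq h => ->; rewrite mulr0.
have /dvd_XnP /(_ n (ltnSn n)) := dvd_Xn_cancel T0 DG.
rewrite coefB coef_dissect // coef_theta3; last by rewrite /N /M; lia.
rewrite coef_poly ltn_pmul2l // ltnSn overcount_overpartition; last by rewrite /N /M; lia.
by move/eqP; rewrite subr_eq0 => /eqP.
Qed.

(** * The Legendre symbol and the conclusion *)

Lemma legendre_nonresidue l (a : int) : prime l -> legendre a l = -1 ->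
  forall r : 'F_l, r ^+ 2 <> a%:~R.
Proof.
move=> pl; rewrite /legendre; case: ifP => // _; case: ifP => // /existsPn h _ r hr.
have rl : (r < l)%N by rewrite -[X in (_ < X)%N](Fp_cast pl).
have /negP := h (Ordinal rl); apply; apply/eqP/dvdz_mod0P.
by rewrite -intr_Fp_eq0 // rmorphB rmorphXn /= -pmulrn natr_Zp hr subrr eqxx.
Qed.

Local Close Scope ring_scope.

Theorem theorem1p4 (k l : nat) :
  prime l -> l %% 5 = 3 ->
  forall n : nat, legendre (- (n%:Z))%R l = (-1)%R ->
  overpartition_count (4 ^ k * 5 * l ^ 2 * n) %% 5 = 0.
Proof.
move=> pl l5 n /(legendre_nonresidue pl) nonres.
have ol : odd l by case: (even_prime pl) l5 => // ->.
have r3_pow4 j m : r3 (4 ^ j * m) = r3 m.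
  by elim: j => [|j IH]; rewrite ?mul1n // expnS -mulnA r3_mul4.
have -> : 4 ^ k * 5 * l ^ 2 * n = 5 * (4 ^ k * (l ^ 2 * n)) by rewrite -!mulnA mulnCA.
apply/eqP; rewrite -/(5 %| _) (dvdn_pcharf (pchar_Fp (isT : prime 5))).
rewrite overpartition_5n_mod5 r3_pow4 (r3_hecke pl ol) => [|r]; last first.
  by have := nonres r; rewrite rmorphN.
(* As [l] is 3 modulo 5, the factor [l + 2] vanishes. *)
rewrite natrM (_ : l.+2%:R = 0)%R ?mul0r ?mulr0 //; apply/eqP.
by rewrite -(dvdn_pcharf (pchar_Fp (isT : prime 5))) /dvdn -addn2 -modnDml l5.
Qed.
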